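(* Let $M=\begin{pmatrix}a&b\\c&d\end{pmatrix}\in\mathrm{Sp}(n,\mathbb{R})$, with $a,b,c,d$ real $n\times n$ matrices. Then $M$ has a decomposition (the pre-Iwasawa decomposition) $$M=\begin{pmatrix}1_n&x\\0&1_n\end{pmatrix}\begin{pmatrix}y&0\\0&y^{-1}\end{pmatrix}\begin{pmatrix}X&Y\\-Y&X\end{pmatrix},$$ where $x,y,X,Y$ are real $n\times n$ matrices, $x$ and $y$ are symmetric, $y$ is positive definite, and the last factor lies in $\mathrm{Sp}(n,\mathbb{R})\cap \mathrm{O}(2n)\cong \mathrm{U}(n)$, i.e. $X^tX+Y^tY=XX^t+YY^t=1_n$, $X^tY=Y^tX$, $YX^t=XY^t$. All the factors are unique, and they are given by $$y=(dd^t+cc^t)^{-1/2},\qquad X-iY=y(d+ic),$$ $$x=ty,\quad\text{where } t:=y^2(db^t+ca^t)y^{-1}=(bd^t+ac^t)y,$$ so that also $$x=(dd^t+cc^t)^{-1}(db^t+ca^t)=(bd^t+ac^t)(dd^t+cc^t)^{-1}.$$ The inverse of the transformation $(a,b,c,d)\mapsto(x,y,X,Y)$ is $$a=yX-xy^{-1}Y,\quad b=yY+xy^{-1}X,\quad c=-y^{-1}Y,\quad d=y^{-1}X.$$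
   Context: $\mathrm{Sp}(n,\mathbb{R})$ is the group of real $2n\times 2n$ matrices $M$ with $M^tJM=J$, $J=\begin{pmatrix}0&1_n\\-1_n&0\end{pmatrix}$; $A^t$ denotes the transpose. For a symmetric positive definite matrix, powers such as $(\cdot)^{-1/2}$ denote the symmetric positive definite power. The isomorphism $\mathrm{Sp}(n,\mathbb{R})\cap \mathrm{O}(2n)\cong\mathrm{U}(n)$ is $\begin{pmatrix}X&Y\\-Y&X\end{pmatrix}\mapsto X+iY$. *)

(* Defs.v *)
From mathcomp Require Export all_boot all_order all_algebra.
From mathcomp Require Export sesquilinear spectral.
From mathcomp Require Export boolp classical_sets reals.
From mathcomp Require Export complex.

Set Implicit Arguments.
Unset Strict Implicit.
Unset Printing Implicit Defensive.

Import Order.TTheory GRing.Theory Num.Theory.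
Local Open Scope ring_scope.

Definition sympJ (R : realType) (n : nat) : 'M[R]_(n + n) :=
  block_mx 0 1%:M (- 1%:M) 0.

Definition symplectic (R : realType) (n : nat) (M : 'M[R]_(n + n)) : Prop :=
  M^T *m sympJ R n *m M = sympJ R n.

Definition orthogonalmx (R : realType) (m : nat) (M : 'M[R]_m) : Prop :=
  M^T *m M = 1%:M.

Definition spdmx (R : realType) (n : nat) (A : 'M[R]_n) : Prop :=
  A \is symmetricmx /\
  forall v : 'cV[R]_n, v != 0 -> 0 < (v^T *m A *m v) 0 0.

(* S^(-1/2), the symmetric positive definite square root of S^-1: the choice
   is between equal matrices when S is symmetric positive definite, since then
   exactly one such root exists. *)
Definition invsqrtmx (R : realType) (n : nat) (S : 'M[R]_n) : 'M[R]_n :=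
  xget 0 [set P : 'M[R]_n | spdmx P /\ P *m P = invmx S]%classic.

Definition cplxmx (R : realType) (n : nat) (A : 'M[R]_n) : 'M[R[i]]_n :=
  map_mx (real_complex R) A.

(* The real form of the complex matrix X + iY. *)
Definition unitary_block (R : realType) (n : nat) (X Y : 'M[R]_n) : 'M[R]_(n + n) :=
  block_mx X Y (- Y) X.

Definition preIwasawa_params (R : realType) (n : nat)
    (x y X Y : 'M[R]_n) : Prop :=
  [/\ x \is symmetricmx, spdmx y,
      symplectic (unitary_block X Y) & orthogonalmx (unitary_block X Y)].

Definition preIwasawa (R : realType) (n : nat) (M : 'M[R]_(n + n))
    (x y X Y : 'M[R]_n) : Prop :=
  preIwasawa_params x y X Y /\
  M = block_mx 1%:M x 0 1%:M *m block_mx y 0 0 (invmx y) *m unitary_block X Y.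

(* Main.v *)
(* For the symmetric positive definite matrix S = dd^t + cc^t, put y = S^(-1/2),
   X = yd and Y = -yc. Symplecticity of M^t makes U = (X Y; -Y X) orthogonal
   and M U^t = (y t; 0 y^-1) block upper triangular; the latter is again
   symplectic, which says that x = ty is symmetric. Conversely M M^t does not
   see the factor U, so its blocks determine y and x, and then U. *)

Require Import Defs.

Set Implicit Arguments.
Unset Strict Implicit.
Unset Printing Implicit Defensive.

Import Order.TTheory GRing.Theory Num.Theory.
Local Open Scope ring_scope.

(** * Symmetric matrices, interpolation, and polynomials in a matrix *)

Lemma symmetricmxP (R : fieldType) (n : nat) (A : 'M[R]_n) :
  reflect (A^T = A) (A \is symmetricmx).
Proof.
by apply: (iffP (is_hermitianmxP _ _ _)); rewrite scale1r map_mx_id.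
Qed.

(** Induction on the nodes: at a new node [x] the value is corrected by a multiple of [q], which
    vanishes at the earlier nodes but not at [x]. *)
Lemma interpolation (F : fieldType) (f : F -> F) (s : seq F) :
  exists p : {poly F}, {in s, forall x, p.[x] = f x}.
Proof.
elim: s => [|x s [p pE]]; first by exists 0.
have [xs|xNs] := boolP (x \in s).
  by exists p => z /[!inE] /predU1P[->|]; apply: pE.
pose q := \prod_(z <- s) ('X - z%:P).
have qx0 : q.[x] != 0 by rewrite -[_ == _]/(root q x) root_prod_XsubC.
exists (p + ((f x - p.[x]) / q.[x]) *: q) => z; rewrite inE hornerD hornerZ.
case/predU1P => [->|zs]; first by rewrite divfK // subrKC.
have /eqP -> : root q z by rewrite root_prod_XsubC.
by rewrite mulr0 addr0 pE.
Qed.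

Lemma trmx_horner_mx (R : comNzRingType) (n : nat) (A : 'M[R]_n.+1)
    (p : {poly R}) : (horner_mx A p)^T = horner_mx A^T p.
Proof.
elim/poly_ind: p => [|p c IHp]; first by rewrite !rmorph0 trmx0.
rewrite !rmorphD !rmorphM /= !horner_mx_X !horner_mx_C raddfD /= tr_scalar_mx.
rewrite trmx_mul IHp; congr (_ + _); exact: comm_mx_horner.
Qed.

(** * Symmetric positive definite matrices and their square roots *)

Section SymmetricPositiveDefinite.
Context {R : realType} {n : nat}.
Implicit Types A B P Q S : 'M[R]_n.

Lemma mulVtmx_ge0 (m : nat) (v : 'cV[R]_m) : 0 <= (v^T *m v) 0 0.
Proof. by rewrite mxE sumr_ge0 // => i _; rewrite mxE -expr2 sqr_ge0. Qed.

Lemma mulVtmx_eq0 (m : nat) (v : 'cV[R]_m) : (v^T *m v) 0 0 = 0 -> v = 0.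
Proof.
rewrite mxE => /psumr_eq0P v0; apply/colP => i; rewrite mxE; apply/eqP.
rewrite -sqrf_eq0 expr2 -{1}[v]trmxK mxE; apply/eqP/v0 => // j _.
by rewrite mxE -expr2 sqr_ge0.
Qed.

Lemma spdmx_tr P : spdmx P -> P^T = P.
Proof. by case=> /symmetricmxP. Qed.

Lemma spdmx_unitmx P : spdmx P -> P \in unitmx.
Proof.
move=> [_ Ppos]; rewrite -row_free_unit -kermx_eq0; apply/rowV0P => v.
move=> /sub_kermxP vP; apply/eqP; rewrite -trmx_eq0.
by apply: contraT => /Ppos; rewrite trmxK vP mul0mx mxE ltxx.
Qed.

Lemma spdmx_sqr B : B^T = B -> B \in unitmx -> spdmx (B *m B).
Proof.
move=> Bsym Bu; split; first by apply/symmetricmxP; rewrite trmx_mul Bsym.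
move=> v v0; have -> : v^T *m (B *m B) *m v = (B *m v)^T *m (B *m v).
  by rewrite trmx_mul Bsym !mulmxA.
rewrite lt_def mulVtmx_ge0 andbT; apply: contra_neq v0 => /mulVtmx_eq0 Bv0.
by rewrite -[v](mulKmx Bu) Bv0 mulmx0.
Qed.

(** The diagonal entries of [D^T P D] are the values of the quadratic form of [P] at the columns of
    [D]. *)
Lemma spdmx_trace_leif P (D : 'M[R]_n) :
  spdmx P -> 0 <= \tr (D^T *m P *m D) ?= iff (D == 0).
Proof.
move=> [_ Ppos].
have trE j : (D^T *m P *m D) j j = ((col j D)^T *m P *m col j D) 0 0.
  rewrite tr_col -row_mul mxE [RHS]mxE; apply: eq_bigr => k _.
  by rewrite [row _ _ _ _]mxE [col _ _ _ _]mxE.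
have tr_ge0 j : 0 <= (D^T *m P *m D) j j.
  rewrite trE; have [->|/Ppos/ltW//] := eqVneq (col j D) 0.
  by rewrite mulmx0 mxE.
split; first exact: sumr_ge0.
rewrite eq_sym; apply/eqP/eqP => [tr0|->]; last by rewrite mulmx0 mxtrace0.
apply/matrixP => i j.
have : (D^T *m P *m D) j j = 0 by apply: (psumr_eq0P _ tr0).
rewrite trE; have [/colP/(_ i)|/Ppos/[swap]->] := eqVneq (col j D) 0.
  by rewrite !mxE.
by rewrite ltxx.
Qed.

(* With [D = P - Q], the sum of the nonnegative traces of [D P D] and [D Q D]
   is the trace of [D (P P - Q Q)]. *)
Lemma spdmx_sqr_inj P Q : spdmx P -> spdmx Q -> P *m P = Q *m Q -> P = Q.
Proof.
move=> Pspd Qspd PQ; pose D := P - Q.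
have Dsym : D^T = D by rewrite raddfB /= !spdmx_tr.
have PDQ : P *m D + D *m Q = 0.
  by rewrite mulmxBr mulmxBl PQ addrA subrK subrr.
have: \tr (D^T *m P *m D) + \tr (D^T *m Q *m D) = 0.
  rewrite [X in _ + X]mxtrace_mulC Dsym -mulmxA -mxtraceD -mulmxDr.
  by rewrite PDQ mulmx0 mxtrace0.
move/eqP; rewrite paddr_eq0 ?(spdmx_trace_leif D _) // => /andP[/eqP/esym/eqP].
rewrite (spdmx_trace_leif D _) // subr_eq0 => /eqP //.
Qed.

(** At a left eigenvector [v] the quadratic form takes the value [l * |v|^2]. *)
Lemma spdmx_eigenvalue_gt0 S (l : R) : spdmx S -> eigenvalue S l -> 0 < l.
Proof.
move=> [_ Spos] /eigenvalueP[v vS v0].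
have /Spos : v^T != 0 by rewrite trmx_eq0.
rewrite trmxK vS -scalemxAl mxE -[v in v *m _]trmxK pmulr_lgt0 //.
rewrite lt_def mulVtmx_ge0 andbT; apply: contra_neq v0 => /mulVtmx_eq0.
by move/(congr1 trmx); rewrite trmxK trmx0.
Qed.

End SymmetricPositiveDefinite.

(* Interpolating [x |-> x^(-1/4)] by a real polynomial on the spectrum of [S]
   keeps the fourth root real, although [S] is diagonalised over [R[i]]. *)
Lemma spdmx_inv_fourth_root (R : realType) (n : nat) (S : 'M[R]_n.+1) :
  spdmx S -> exists2 B : 'M[R]_n.+1, B^T = B & B ^+ 4 * S = 1.
Proof.
move=> Sspd; have Ssym := spdmx_tr Sspd.
pose C := cplxmx S; pose U := spectralmx C; pose d := spectral_diag C.
have Uu : U \in unitmx := spectral_unit C.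
have Cherm : C \is hermsymmx.
  apply: realsym_hermsym.
    by apply/symmetricmxP; rewrite /C /cplxmx map_trmx Ssym.
  by apply/mxOverP => i j; rewrite mxE complex_real.
have CE : C = invmx U *m diag_mx d *m U.
  exact/orthomx_spectralP/hermitian_normalmx.
pose l i := complex.Re (d 0 i).
have lE i : d 0 i = real_complex R (l i).
  by rewrite /l RRe_real //; apply/mxOverP/hermitian_spectral_diag_real.
(* Row [i] of [U] is a left eigenvector of [C] for [l i]; since [l i] is real, it is already an
   eigenvalue of [S] over [R], hence positive. *)
have l_gt0 i : 0 < l i.
  apply: (spdmx_eigenvalue_gt0 Sspd).
  rewrite -(eigenvalue_map (real_complex R)) /= -lE; apply/eigenvalueP.
  exists (row i U).
    rewrite -[map_mx _ _]/C CE -row_mul !mulmxA mulmxV // mul1mx.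
    by rewrite row_mul row_diag_mx -scalemxAl -rowE.
  apply: contraTneq isT; rewrite rowE => /(congr1 (mulmx^~ (invmx U))).
  rewrite mulmxK // mul0mx => /rowP/(_ i)/eqP.
  by rewrite !mxE !eqxx oner_eq0.
pose f (x : R) := Num.sqrt (Num.sqrt x^-1).
have [p pE] := interpolation f [seq l i | i : 'I_n.+1].
exists (horner_mx S p); first by rewrite trmx_horner_mx Ssym.
have hE : horner_mx S (p ^+ 4 * 'X) = horner_mx S p ^+ 4 * S.
  by rewrite rmorphM rmorphXn /= horner_mx_X.
(* The identity is checked over [R[i]], where the polynomial acts on each diagonal entry and gives
   [(l i)^-1 * l i = 1]. *)
rewrite -hE; apply: (@map_mx_inj _ _ (real_complex R)).
rewrite map_horner_mx -[map_mx _ S]/C CE horner_mx_uconjC // horner_mx_diag.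
rewrite map_mx1; set D := diag_mx _.
suff -> : D = 1%:M by rewrite mulmx1 mulVmx.
rewrite -diag_const_mx; congr diag_mx; apply/rowP => i; rewrite !mxE lE.
rewrite horner_map /= hornerM hornerX horner_exp pE ?map_f ?mem_enum //.
rewrite /f -[4%N]/(2 * 2)%N exprM !sqr_sqrtr ?sqrtr_ge0 ?invr_ge0 ?ltW //.
by rewrite mulVf ?gt_eqF.
Qed.

Lemma invsqrtmx_unique (R : realType) (n : nat) (S P : 'M[R]_n) :
  spdmx P -> P *m P = invmx S -> invsqrtmx S = P.
Proof.
move=> Pspd PP; apply: xget_unique => [//|Q [Qspd QQ]].
by apply: spdmx_sqr_inj; rewrite // PP QQ.
Qed.

(** The root is [B *m B] with [B] a symmetric fourth root of [S^-1]: the square of an invertible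
    symmetric matrix is automatically positive definite, whatever the signs of the eigenvalues of
    [B]. *)
Lemma invsqrtmxP (R : realType) (n : nat) (S : 'M[R]_n) : spdmx S ->
  spdmx (invsqrtmx S) /\ invsqrtmx S *m invsqrtmx S = invmx S.
Proof.
move=> Sspd; suff [P [Pspd PP]] : exists P, spdmx P /\ P *m P = invmx S.
  by rewrite (invsqrtmx_unique Pspd PP).
(* In size 0 all matrices are equal, so [S] itself serves as the root. *)
case: n S Sspd => [|n] S Sspd; first by exists S; split=> //; rewrite !flatmx0.
have [B Bsym BS] := spdmx_inv_fourth_root Sspd; exists (B *m B).
have Su := spdmx_unitmx Sspd.
have B4 : B *m B *m (B *m B) = invmx S.
  rewrite -[RHS]mul1mx; apply: (canRL (mulmxK Su)); rewrite -[RHS]BS.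
  by rewrite !mulmxE !exprS expr0 mulr1 !mulrA.
split=> //; apply: spdmx_sqr => //; move: (unitmx_inv S); rewrite Su -B4.
by rewrite !unitmx_mul => /andP[/andP[]].
Qed.

(** * Symplectic, orthogonal and unitary matrices in block form *)

(** As [J^2 = -1], the hypothesis makes [- J M^T J] a left inverse of [M], hence a right inverse;
    multiplying by [J] on the right gives [M J M^T = J]. *)
Lemma symplectic_tr (R : realType) (n : nat) (M : 'M[R]_(n + n)) :
  symplectic M -> symplectic M^T.
Proof.
have JJ : sympJ R n *m sympJ R n = - 1%:M.
  rewrite mulmx_block !mul0mx !mulmx0 mul1mx mulmx1 !add0r !addr0.
  by rewrite (scalar_mx_block n n) opp_block_mx oppr0.
rewrite /symplectic trmxK => MJM.
have /mulmx1C : (- (sympJ R n *m M^T *m sympJ R n)) *m M = 1%:M.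
  by rewrite mulNmx -!mulmxA mulmxA -mulmxA [M^T *m _]mulmxA MJM JJ opprK.
move/(congr1 (mulmx^~ (sympJ R n))); rewrite mul1mx mulmxN mulNmx !mulmxA.
by rewrite -[_ *m _ *m sympJ R n]mulmxA JJ mulmxN mulmx1 opprK.
Qed.

Lemma symplectic_mul (R : realType) (n : nat) (M N : 'M[R]_(n + n)) :
  symplectic M -> symplectic N -> symplectic (M *m N).
Proof.
rewrite /symplectic trmx_mul => MJM NJN.
by rewrite -!mulmxA (mulmxA _ M) (mulmxA M^T) (mulmxA M^T) MJM mulmxA.
Qed.

Lemma symplectic_block (R : realType) (n : nat) (a b c d : 'M[R]_n) :
  symplectic (block_mx a b c d) <->
  [/\ a^T *m c = c^T *m a, b^T *m d = d^T *m b & a^T *m d - c^T *m b = 1%:M].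
Proof.
rewrite /symplectic /sympJ tr_block_mx !mulmx_block.
rewrite !(mulmx0, mulmx1, mulmxN, add0r, addr0, mulNmx).
rewrite ![- _ + _]addrC; split=> [/eq_block_mx[/subr0_eq ac ad _ /subr0_eq]//|].
move=> [-> -> ad]; rewrite !subrr ad; congr block_mx.
(* The lower left block equation is the negated transpose of the upper right one. *)
by rewrite -[1%:M]trmx1 -ad linearB /= !trmx_mul !trmxK opprB.
Qed.

Lemma orthogonal_unitary_block (R : realType) (n : nat) (X Y : 'M[R]_n) :
  orthogonalmx (unitary_block X Y) <->
  X^T *m X + Y^T *m Y = 1%:M /\ X^T *m Y = Y^T *m X.
Proof.
rewrite /orthogonalmx /unitary_block tr_block_mx linearN /= mulmx_block.
rewrite !(mulNmx, mulmxN, opprK) (scalar_mx_block n n).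
split=> [/eq_block_mx[-> /subr0_eq->]//|[XX XY]].
by rewrite XX XY !subrr addrC XX.
Qed.

Lemma orthogonalmx_tr (R : realType) (m : nat) (M : 'M[R]_m) :
  orthogonalmx M <-> orthogonalmx M^T.
Proof. by rewrite /orthogonalmx trmxK; split=> /mulmx1C. Qed.

Lemma unitary_block_tr (R : realType) (n : nat) (X Y : 'M[R]_n) :
  (unitary_block X Y)^T = unitary_block X^T (- Y^T).
Proof. by rewrite /unitary_block tr_block_mx linearN opprK. Qed.

(** Orthogonality passes to the transpose, which has the same block shape with [X^T] and [- Y^T]. *)
Lemma orthogonal_unitary_block_tr (R : realType) (n : nat) (X Y : 'M[R]_n) :
  orthogonalmx (unitary_block X Y) <->
  X *m X^T + Y *m Y^T = 1%:M /\ Y *m X^T = X *m Y^T.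
Proof.
rewrite orthogonalmx_tr unitary_block_tr orthogonal_unitary_block.
rewrite [(- _)^T]linearN /= !trmxK !(mulNmx, mulmxN, opprK).
by split=> -[-> E]; split=> //; [apply: oppr_inj | congr (- _)].
Qed.

(** For this block shape the symplectic relations turn into the orthogonality relations. *)
Lemma symplectic_unitary_block (R : realType) (n : nat) (X Y : 'M[R]_n) :
  orthogonalmx (unitary_block X Y) -> symplectic (unitary_block X Y).
Proof.
rewrite orthogonal_unitary_block symplectic_block [(- _)^T]linearN /=.
move=> [XX XY].
by rewrite mulmxN !mulNmx opprK XY.
Qed.

Lemma cplxmx_ReIm_inj (R : realType) (n : nat) (A B A' B' : 'M[R]_n) :
  cplxmx A + 'i%C *: cplxmx B = cplxmx A' + 'i%C *: cplxmx B' ->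
  A = A' /\ B = B'.
Proof.
move=> /matrixP E.
have {}E i j : A i j = A' i j /\ B i j = B' i j.
  have := E i j; rewrite !mxE => -[].
  by rewrite !(mul0r, mul1r, subr0, addr0, add0r).
by split; apply/matrixP => i j; case: (E i j).
Qed.

(** The product of [X + iY] with its adjoint is [(X X^T + Y Y^T) + i (Y X^T - X Y^T)]; real and
    imaginary parts are compared with those of the identity. *)
Lemma unitarymx_cplx (R : realType) (n : nat) (X Y : 'M[R]_n) :
  orthogonalmx (unitary_block X Y) <->
  cplxmx X + 'i%C *: cplxmx Y \is unitarymx.
Proof.
rewrite orthogonal_unitary_block_tr.
have adjE : map_mx Num.conj (cplxmx X + 'i%C *: cplxmx Y)^T =
            cplxmx X^T - 'i%C *: cplxmx Y^T.
  apply/matrixP => i j; rewrite !mxE; apply/eqP; rewrite eq_complex /=.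
  by rewrite !(mul0r, mul1r, subr0, addr0, add0r, oppr0) !eqxx.
have prodE : (cplxmx X + 'i%C *: cplxmx Y) *m (cplxmx X^T - 'i%C *: cplxmx Y^T)
    = cplxmx (X *m X^T + Y *m Y^T) + 'i%C *: cplxmx (Y *m X^T - X *m Y^T).
  rewrite /cplxmx !(map_mxD, map_mxM, map_mxN) /= !mulmxDl !mulmxDr !mulmxN.
  rewrite -!scalemxAr -!scalemxAl scalerA -expr2 sqr_i scaleN1r opprK.
  by rewrite scalerBr addrACA [RHS]addrACA [- _ + _]addrC.
have oneE : 1%:M = cplxmx 1%:M + 'i%C *: cplxmx (0 : 'M[R]_n).
  by rewrite /cplxmx map_mx1 map_mx0 scaler0 addr0.
split=> [[XX XY]|/unitarymxP]; last first.
  by rewrite adjE prodE oneE => /cplxmx_ReIm_inj[-> /subr0_eq].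
by apply/unitarymxP; rewrite adjE prodE XX XY subrr -oneE.
Qed.

(** * The pre-Iwasawa decomposition: uniqueness, existence and inverse *)

Lemma preIwasawa_productE (R : realType) (n : nat) (x y X Y : 'M[R]_n) :
  block_mx 1%:M x 0 1%:M *m block_mx y 0 0 (invmx y) *m unitary_block X Y =
  block_mx (y *m X - x *m invmx y *m Y) (y *m Y + x *m invmx y *m X)
           (- (invmx y *m Y)) (invmx y *m X).
Proof.
by rewrite !mulmx_block !(mulmx0, mul0mx, mul1mx, addr0, add0r, mulmxN).
Qed.

(** Each factor is symplectic, the first because [x] is symmetric, the second because [y] is. Thus
    all admissible parameters come from a symplectic matrix. *)
Lemma preIwasawa_symplectic (R : realType) (n : nat) (M : 'M[R]_(n + n))
    (x y X Y : 'M[R]_n) : preIwasawa M x y X Y -> symplectic M.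
Proof.
move=> [[/symmetricmxP xsym yspd Usymp _] ->]; apply: symplectic_mul => //.
have yu := spdmx_unitmx yspd; have ysym := spdmx_tr yspd.
apply: symplectic_mul; apply/symplectic_block.
  by rewrite trmx0 trmx1 !(mul0mx, mulmx0, mul1mx, mulmx1) xsym subr0.
by rewrite trmx0 !(mul0mx, mulmx0) subr0 ysym mulmxV.
Qed.

Lemma preIwasawa_factors (R : realType) (n : nat) (a b c d x y X Y : 'M[R]_n) :
  preIwasawa (block_mx a b c d) x y X Y ->
  let S := d *m d^T + c *m c^T in
  [/\ x = (b *m d^T + a *m c^T) *m invmx S, y = invsqrtmx S,
      X = y *m d & Y = - (y *m c)].
Proof.
move=> [[_ yspd _ Uorth] ME] S.
have yu := spdmx_unitmx yspd; have ysym := spdmx_tr yspd.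
move/orthogonalmx_tr: Uorth; rewrite /orthogonalmx trmxK => UU.
have [_ _ cE dE] := eq_block_mx (etrans ME (preIwasawa_productE x y X Y)).
(* The orthogonal factor cancels in [M M^T], whose right blocks read [x y^-2 = a c^T + b d^T] and
   [y^-2 = S]. *)
have := congr1 (fun N => N *m N^T) ME.
rewrite trmx_mul mulmxA -[_ *m _ *m (unitary_block X Y)^T]mulmxA UU mulmx1.
rewrite mulmx_block !(mul0mx, mulmx0, mul1mx, addr0, add0r).
rewrite !tr_block_mx !mulmx_block trmx0 trmx_inv ysym.
rewrite !(mulmx0, add0r) => /eq_block_mx[_ tE _ SE].
have yyS : y *m y *m S = 1%:M by rewrite /S addrC SE mulmxA mulmxK ?mulmxV.
have [_ Su] := mulmx1_unit yyS.
have Sinv : invmx S = y *m y by rewrite -[LHS]mul1mx -yyS mulmxK.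
split.
- by rewrite Sinv addrC tE !mulmxA !mulmxKV.
- by rewrite (invsqrtmx_unique yspd) // Sinv.
- by rewrite dE mulKVmx.
- by rewrite cE mulmxN opprK mulKVmx.
Qed.

Lemma preIwasawa_exists (R : realType) (n : nat) (a b c d : 'M[R]_n) :
  symplectic (block_mx a b c d) ->
  let S := d *m d^T + c *m c^T in let y := invsqrtmx S in
  spdmx S /\
  preIwasawa (block_mx a b c d) ((b *m d^T + a *m c^T) *m invmx S) y
    (y *m d) (- (y *m c)).
Proof.
move=> Msymp S y.
(* The relations for [M^T] that are kept are [c d^T = d c^T] and [a d^T - b c^T = 1]. *)
have := symplectic_tr Msymp; rewrite tr_block_mx.
move/symplectic_block; rewrite !trmxK => -[_ cd ad].
have Sspd : spdmx S.
  split.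
    by apply/symmetricmxP; rewrite linearD /= !trmx_mul !trmxK.
  move=> v v0.
  have SE : v^T *m S *m v =
      (d^T *m v)^T *m (d^T *m v) + (c^T *m v)^T *m (c^T *m v).
    by rewrite mulmxDr mulmxDl !trmx_mul !trmxK !mulmxA.
  rewrite SE mxE lt_def addr_ge0 ?mulVtmx_ge0 // andbT.
  rewrite paddr_eq0 ?mulVtmx_ge0 //; apply: contra_neqN v0.
  move=> /andP[/eqP/mulVtmx_eq0 dv /eqP/mulVtmx_eq0 cv].
  (* A vector killed by [d^T] and [c^T] is zero, being equal to [(a d^T - b c^T) v]. *)
  by rewrite -[v]mul1mx -ad mulmxBl -!mulmxA dv cv !mulmx0 subr0.
have [yspd yy] := invsqrtmxP Sspd; rewrite -/y in yspd yy.
have yu := spdmx_unitmx yspd; have ysym := spdmx_tr yspd.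
have Su := spdmx_unitmx Sspd.
have Sy : S *m y = invmx y.
  by rewrite -[LHS](mulmxK yu) -(mulmxA S) yy mulmxV // mul1mx.
split=> //.
set x := _ *m invmx S; set X := y *m d; set Y := - (y *m c).
have Uorth : orthogonalmx (unitary_block X Y).
  apply/orthogonal_unitary_block_tr.
  rewrite /X /Y [(- _)^T]linearN /= !trmx_mul ysym.
  rewrite !(mulNmx, mulmxN, opprK) !mulmxA -!(mulmxA y) cd; split=> //.
  by rewrite -mulmxDr -mulmxDl -/S Sy mulmxV.
pose t := (b *m d^T + a *m c^T) *m y.
have xE : x = t *m y by rewrite /x -yy mulmxA.
(* Up to the right factor [y], the left blocks are [a d^T - b c^T = 1] and [c d^T - d c^T = 0]; the
   lower right block is [S y = y^-1]. *)
have TE : block_mx a b c d *m (unitary_block X Y)^T =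
          block_mx y t 0 (invmx y).
  rewrite unitary_block_tr mulmx_block /X /Y [(- _)^T]linearN /= opprK.
  rewrite !trmx_mul ysym opprK !mulmxN !mulmxA -!mulmxBl -!mulmxDl.
  by rewrite ad cd subrr mul0mx mul1mx [a *m _ + _]addrC [c *m _ + _]addrC Sy.
have xsym : x^T = x.
  have: symplectic (block_mx y t 0 (invmx y)).
    rewrite -TE; apply: symplectic_mul => //.
    exact/symplectic_tr/symplectic_unitary_block.
  move/symplectic_block => [_ ty _].
  (* The relation on the right block column is [t^T y^-1 = y^-1 t], that is, [y t^T = t y]. *)
  rewrite xE trmx_mul ysym -[t^T](mulmxKV yu) ty trmx_inv ysym.
  by rewrite !mulmxA mulmxV // mul1mx.
split; first split=> //.
- exact/symmetricmxP.
- exact: symplectic_unitary_block.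
(* Writing [M = (M U^T) U], it remains to split the triangular matrix [M U^T] into its unipotent and
   diagonal factors. *)
rewrite -[LHS]mulmx1 -[1%:M]Uorth mulmxA TE; congr (_ *m _).
by rewrite mulmx_block !(mulmx0, mul0mx, mul1mx, addr0, add0r) xE mulmxK.
Qed.

Theorem lemma4 (R : realType) (n : nat) :
  [/\ (* pre-Iwasawa decomposition: existence, uniqueness, formulas *)
      forall a b c d : 'M[R]_n, symplectic (block_mx a b c d) ->
      exists x y X Y : 'M[R]_n,
      [/\ preIwasawa (block_mx a b c d) x y X Y,
          forall x' y' X' Y' : 'M[R]_n,
            preIwasawa (block_mx a b c d) x' y' X' Y' ->
            [/\ x' = x, y' = y, X' = X & Y' = Y],
          [/\ spdmx (d *m d^T + c *m c^T),
              y = invsqrtmx (d *m d^T + c *m c^T) &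
              cplxmx X - 'i%C *: cplxmx Y =
              cplxmx y *m (cplxmx d + 'i%C *: cplxmx c)],
          (let t := y ^+ 2 *m (d *m b^T + c *m a^T) *m invmx y in
           t = (b *m d^T + a *m c^T) *m y /\ x = t *m y) &
          x = invmx (d *m d^T + c *m c^T) *m (d *m b^T + c *m a^T) /\
          x = (b *m d^T + a *m c^T) *m invmx (d *m d^T + c *m c^T)],
      (* description of the last factor *)
      forall X Y : 'M[R]_n,
      (symplectic (unitary_block X Y) /\ orthogonalmx (unitary_block X Y) <->
       [/\ X^T *m X + Y^T *m Y = 1%:M, X *m X^T + Y *m Y^T = 1%:M,
           X^T *m Y = Y^T *m X & Y *m X^T = X *m Y^T]) /\
      (symplectic (unitary_block X Y) /\ orthogonalmx (unitary_block X Y) <->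
       cplxmx X + 'i%C *: cplxmx Y \is unitarymx) &
      (* the transformation and its inverse *)
      forall a b c d x y X Y : 'M[R]_n,
      symplectic (block_mx a b c d) /\ preIwasawa (block_mx a b c d) x y X Y
      <->
      preIwasawa_params x y X Y /\
      [/\ a = y *m X - x *m invmx y *m Y, b = y *m Y + x *m invmx y *m X,
          c = - (invmx y *m Y) & d = invmx y *m X]].
Proof.
split.
- move=> a b c d Msymp; have [Sspd Mdec] := preIwasawa_exists Msymp.
  set S := d *m d^T + c *m c^T in Sspd Mdec *.
  have [yspd yy] := invsqrtmxP Sspd.
  set y := invsqrtmx S in yspd yy Mdec *.
  have yu := spdmx_unitmx yspd.
  set x := (b *m d^T + a *m c^T) *m invmx S in Mdec *.
  (* Since [x] is symmetric, transposing one formula for it gives the other. *)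
  have xtE : x = invmx S *m (d *m b^T + c *m a^T).
    have [[/symmetricmxP <- _ _ _] _] := Mdec.
    by rewrite trmx_mul trmx_inv (spdmx_tr Sspd) linearD /= !trmx_mul !trmxK.
  have tE : invmx S *m (d *m b^T + c *m a^T) *m invmx y =
            (b *m d^T + a *m c^T) *m y.
    by rewrite -xtE /x -yy !mulmxA mulmxK.
  exists x, y, (y *m d), (- (y *m c)); split=> //.
  + by move=> x' y' X' Y' /preIwasawa_factors[-> -> -> ->].
  + split=> //; rewrite /cplxmx map_mxN !map_mxM /= scalerN opprK.
    by rewrite mulmxDr scalemxAr.
  + by rewrite expr2 -mulmxE yy tE /x -mulmxA yy.
- move=> X Y; split.
    split=> [[_ Uorth]|[XX _ XY _]].
      have [XX XY] := (orthogonal_unitary_block X Y).1 Uorth.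
      by have [XX' YX] := (orthogonal_unitary_block_tr X Y).1 Uorth.
    have Uorth : orthogonalmx (unitary_block X Y).
      exact/orthogonal_unitary_block.
    by split=> //; apply: symplectic_unitary_block.
  split=> [[_ /unitarymx_cplx]//|/unitarymx_cplx Uorth].
  by split=> //; apply: symplectic_unitary_block.
move=> a b c d x y X Y; split.
  move=> [_ [params]]; rewrite preIwasawa_productE.
  by move=> /eq_block_mx[-> -> -> ->].
(* The four formulas are the blocks of the product of the three factors, so symplecticity follows
   from that of the factors. *)
move=> [params [-> -> -> ->]]; rewrite -preIwasawa_productE.
by split; [apply: (@preIwasawa_symplectic _ _ _ x y X Y)|].
Qed.
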